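(* Let $f\in\mathbb{Q}(x)$ be a normalized Belyi map of combinatorial type $(d; e_1,e_2,e_3)$. Suppose there is a prime $p$ and an integer $\ell$ such that at least one of the following holds: (1) $p=2$, $2\mid d$ and $\ell=\nu_2(d)$; (2) $p=3$, $3\mid d$ and $\ell=\nu_3(d)$; (3) $d=p^\ell$. Assume moreover that $e_2\le p^\ell$. Then $\mathrm{PrePer}(f,\mathbb{Q})$ consists entirely of the rational fixed points of $f$ and their rational preimages; that is, every periodic point of $f$ in $\mathbb{P}^1(\mathbb{Q})$ is a fixed point, so every $P\in\mathrm{PrePer}(f,\mathbb{Q})$ satisfies $f^m(P)=f^{m+1}(P)$ for some $m\ge 0$.
   Context: A normalized Belyi map of combinatorial type $(d; e_1,e_2,e_3)$ (with integers $2\le e_i\le d$, $e_1+e_2+e_3=2d+1$) is a rational function $f$ of degree $d$, viewed as a map $\mathbb{P}^1\to\mathbb{P}^1$ over $\mathbb{C}$, whose only ramification points are $0,1,\infty$, with ramification indices $e_1,e_2,e_3$ respectively, and with $f(0)=0$, $f(1)=1$, $f(\infty)=\infty$; such $f$ has rational coefficients. $\nu_p$ denotes the $p$-adic valuation. $f^n$ is the $n$-fold iterate of $f$. A point $P$ is preperiodic if $f^n(P)=f^m(P)$ for some integers $n\ne m\ge 0$, and $\mathrm{PrePer}(f,\mathbb{Q})$ is the set of preperiodic points of $f$ in $\mathbb{P}^1(\mathbb{Q})$. *)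

(* Defs.v *)
From mathcomp Require Import all_boot all_order all_algebra.
From mathcomp Require Import fraction reals complex.

Set Implicit Arguments.
Unset Strict Implicit.
Unset Printing Implicit Defensive.

Import GRing.Theory.
Local Open Scope ring_scope.

Local Notation "x %:F" := (FracField.tofrac x).

(* [Some x] is the affine point x = (x : 1); [None] is infinity = (1 : 0). *)
Definition P1 (K : Type) := option K.

Definition affine (K : Type) (x : K) : P1 K := Some x.
Definition infty (K : Type) : P1 K := None.
Arguments infty {K}.

Section RationalFunction.
Variable K : fieldType.
Implicit Types (f : {fraction {poly K}}) (P : P1 K).

(* Numerator and denominator in lowest terms; the pair is determined by f up   *)
(* to a common nonzero constant, and nothing below depends on that constant.   *)
Definition numr f : {poly K} :=
  \n_(repr f) %/ gcdp \n_(repr f) \d_(repr f).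
Definition denr f : {poly K} :=
  \d_(repr f) %/ gcdp \n_(repr f) \d_(repr f).

Definition degr f : nat := maxn (size (numr f)).-1 (size (denr f)).-1.

(* At infinity the homogenizations of degree [degr f] are evaluated at (1 : 0). *)
Definition evalr f P : P1 K :=
  match P with
  | Some x => if (denr f).[x] == 0 then infty
              else affine ((numr f).[x] / (denr f).[x])
  | None => if (denr f)`_(degr f) == 0 then infty
            else affine ((numr f)`_(degr f) / (denr f)`_(degr f))
  end.

(* Order of vanishing at P of a nonzero f (negative at a pole).  At infinity   *)
(* the uniformizer is 1/X, so the order is deg (denominator) - deg (numerator). *)
Definition ordr f P : int :=
  match P with
  | Some x => (mup x (numr f))%:Z - (mup x (denr f))%:Z
  | None => (size (denr f))%:Z - (size (numr f))%:Z
  end.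

(* Order of vanishing at P of u o f, where u is the uniformizer at f(P):       *)
(* u = X - y if f(P) = y is finite and u = 1/X if f(P) = infinity.             *)
(* Only meaningful when f is not constant.                                     *)
Definition ramification_index f P : int :=
  match evalr f P with
  | Some y => ordr (f - (y%:P)%:F) P
  | None => ordr f^-1 P
  end.

Definition ramified f P : bool := ramification_index f P != 1.

Definition normalized_belyi f (d e1 e2 e3 : nat) : Prop :=
  [/\ [/\ (2 <= e1 <= d)%N, (2 <= e2 <= d)%N, (2 <= e3 <= d)%N
        & (e1 + e2 + e3 = 2 * d + 1)%N],
      degr f = d,
      (forall P, ramified f P -> [\/ P = affine 0, P = affine 1 | P = infty]),
      [/\ ramification_index f (affine 0) = e1%:Z,
          ramification_index f (affine 1) = e2%:Z
        & ramification_index f infty = e3%:Z]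
    & [/\ evalr f (affine 0) = affine 0,
          evalr f (affine 1) = affine 1
        & evalr f infty = infty]].

End RationalFunction.

Definition map_frac (K L : fieldType) (g : K -> L) (f : {fraction {poly K}}) :
    {fraction {poly L}} :=
  (map_poly g (numr f))%:F / (map_poly g (denr f))%:F.

Definition complexify (R : realType) (f : {fraction {poly rat}}) :
    {fraction {poly (complex R)}} :=
  map_frac (ratr : rat -> complex R) f.

Definition periodic (T : Type) (f : T -> T) (P : T) : Prop :=
  exists2 n : nat, (0 < n)%N & iter n f P = P.

Definition preperiodic (T : Type) (f : T -> T) (P : T) : Prop :=
  exists n m : nat, n <> m /\ iter n f P = iter m f P.

(* Main.v *)
(* The ramification data say that f = n/m in lowest terms with X^e1 | n,
   (X - 1)^e2 | n - m, deg n = d and deg m = d - e3.  Scale n and m so that they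
   are p-integral and not both zero mod p.  Since e2 <= p^l and p^l | d, also
   (X - 1)^e2 divides X^d - 1 mod p, hence X^e1 (X - 1)^e2 divides n - X^d m
   mod p, whose degree is at most 2d - e3 = e1 + e2 - 1.  So n = X^d m, and by
   degree m is constant: f has good reduction X^d.  In each of the three cases
   X^d fixes its image on P^1(F_p), and as p | d the map f is p-adically
   contracting on residue discs.  Hence f^k(P) and f^(k+1)(P) agree mod p^k for
   all k, which forces f(P) = P when P is periodic. *)
Require Import Defs.
From mathcomp Require Import all_boot all_order all_algebra all_field.
From mathcomp Require Import fraction reals complex.
From mathcomp Require Import ring zify.

Set Implicit Arguments.
Unset Strict Implicit.
Unset Printing Implicit Defensive.

Import GRing.Theory Num.Theory.
Local Open Scope ring_scope.

Local Notation "x %:F" := (FracField.tofrac x).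

(** * Fractions in lowest terms and their ramification *)

Section LowestTerms.
Variable K : fieldType.
Implicit Types (f : {fraction {poly K}}) (n m q : {poly K}).

Lemma denr_neq0 f : denr f != 0.
Proof.
rewrite /denr -size_poly_eq0 size_divp; last first.
  by rewrite gcdp_eq0 negb_and denom_ratioP orbT.
have := leq_gcdpr \n_(repr f) (denom_ratioP (repr f)).
have: (0 < size (\d_(repr f)))%N by rewrite size_poly_gt0 denom_ratioP.
have: (0 < size (gcdp \n_(repr f) \d_(repr f)))%N.
  by rewrite size_poly_gt0 gcdp_eq0 negb_and denom_ratioP orbT.
lia.
Qed.

Lemma coprimep_numr_denr f : coprimep (numr f) (denr f).
Proof.
by rewrite /numr /denr coprimep_div_gcd // denom_ratioP orbT.
Qed.

Lemma fracE_repr f : f = (\n_(repr f))%:F / (\d_(repr f))%:F.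
Proof.
rewrite -[f in LHS]reprK; set r := repr f.
apply: (mulIf (x := (\d_r)%:F)); first by rewrite tofrac_eq0 denom_ratioP.
rewrite mulfVK ?tofrac_eq0 ?denom_ratioP //.
(* Opening [tofrac] exhibits the product as the class of a product of ratios, so that equality
   becomes a cross-multiplied identity of polynomials. *)
unlock FracField.tofrac; rewrite -[LHS]FracField.pi_mul.
apply/eqmodP => /=; rewrite /FracField.equivf /FracField.mulf /=.
by rewrite !numden_Ratio ?oner_eq0 ?mulf_neq0 ?denom_ratioP ?oner_eq0 // !mulr1 mulrC.
Qed.

Lemma fracE f : f = (numr f)%:F / (denr f)%:F.
Proof.
rewrite [LHS]fracE_repr.
have /divpK En := dvdp_gcdl \n_(repr f) \d_(repr f).
have /divpK Ed := dvdp_gcdr \n_(repr f) \d_(repr f).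
rewrite -[X in X%:F / _]En -[X in _ / X%:F]Ed !rmorphM /= -/(numr f) -/(denr f).
rewrite -mulf_div mulfV ?mulr1 // tofrac_eq0 gcdp_eq0 negb_and.
by rewrite denom_ratioP orbT.
Qed.

Lemma eq_tofrac_div f n m : m != 0 ->
  f = n%:F / m%:F -> numr f * m = n * denr f.
Proof.
move=> m0 E; have d0 := denr_neq0 f.
have := fracE f; rewrite [in LHS]E => /eqP.
by rewrite eqr_div ?tofrac_eq0 // -!tofracM tofrac_eq => /eqP.
Qed.

(** By Gauss's lemma the two denominators divide each other. Hence conditions phrased with [numr]
    and [denr] can be read off any coprime pair. *)
Lemma lowest_terms_unique f n m : m != 0 -> coprimep n m ->
  f = n%:F / m%:F -> exists2 k, k != 0 & numr f = k *: n /\ denr f = k *: m.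
Proof.
move=> m0 cnm /(eq_tofrac_div m0) E.
have dvd1 : m %| denr f.
  have : m %| n * denr f by rewrite -E dvdp_mull.
  by rewrite Gauss_dvdpr // coprimep_sym.
have dvd2 : denr f %| m.
  have : denr f %| numr f * m by rewrite E dvdp_mull.
  by rewrite Gauss_dvdpr // coprimep_sym coprimep_numr_denr.
have /eqpf_eq[k k0 Ek] : denr f %= m by rewrite /eqp dvd1 dvd2.
exists k => //; split=> //.
by apply: (mulIf m0); rewrite E Ek -scalerAr scalerAl.
Qed.

Lemma ordr_frac_affine f n m x : n != 0 -> m != 0 -> f = n%:F / m%:F ->
  ordr f (Some x) = (mup x n)%:Z - (mup x m)%:Z.
Proof.
move=> n0 m0 /(eq_tofrac_div m0) E; rewrite /ordr.
have d0 := denr_neq0 f.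
have N0 : numr f != 0.
  by apply: contra_eq_neq E => ->; rewrite mul0r eq_sym mulf_neq0.
have := congr1 (mup x) E; rewrite !mupM //; lia.
Qed.

Lemma ordr_frac_infty f n m : n != 0 -> m != 0 -> f = n%:F / m%:F ->
  ordr f None = (size m)%:Z - (size n)%:Z.
Proof.
move=> n0 m0 /(eq_tofrac_div m0) E; rewrite /ordr.
have d0 := denr_neq0 f.
have N0 : numr f != 0.
  by apply: contra_eq_neq E => ->; rewrite mul0r eq_sym mulf_neq0.
have : size (numr f * m) = size (n * denr f) by rewrite E.
rewrite !size_mul //.
have : (0 < size n)%N by rewrite size_poly_gt0.
have : (0 < size m)%N by rewrite size_poly_gt0.
have : (0 < size (numr f))%N by rewrite size_poly_gt0.
have : (0 < size (denr f))%N by rewrite size_poly_gt0.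
move: (size n) (size m) (size (numr f)) (size (denr f)) => a b c e. lia.
Qed.

(** At infinity, [e3] is the excess of deg n over deg m; being positive, it makes deg n the degree
    of f. The indices at 0 and 1 bound root multiplicities of n and n - m from below. *)
Lemma normalized_belyi_lowest_terms f d e1 e2 e3 n m :
  m != 0 -> coprimep n m -> f = n%:F / m%:F ->
  normalized_belyi f d e1 e2 e3 ->
  [/\ (e1 + e2 + e3 = 2 * d + 1)%N, (2 <= e1 <= d)%N, (2 <= e2 <= d)%N
     & (2 <= e3 <= d)%N] /\
  [/\ size n = d.+1, (size m + e3 = d.+1)%N,
      'X^e1 %| n & ('X - 1) ^+ e2 %| n - m].
Proof.
move=> m0 cnm E [[h1 h2 h3 hs] hd _ [r0 r1 ri] [v0 v1 vi]].
split=> //.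
have [k k0 [En Em]] := lowest_terms_unique m0 cnm E.
have size_n : size (numr f) = size n by rewrite En size_scale.
have size_m : size (denr f) = size m by rewrite Em size_scale.
(* If n vanished, coprimality would make m constant and the degree 0, but d is at least 2. *)
have n0 : n != 0.
  apply/eqP => n0; move: hd; rewrite /degr size_n n0 size_poly0 max0n /= => hd.
  move: cnm; rewrite n0 coprime0p -size_poly_eq1 -size_m => /eqP sm1.
  by move: hd h1; rewrite sm1 /= => <-; lia.
have sm0 : (0 < size m)%N by rewrite size_poly_gt0.
have sn0 : (0 < size n)%N by rewrite size_poly_gt0.
have szm : (size m + e3 = size n)%N.
  move: ri; rewrite /ramification_index vi.
  have -> : ordr f^-1 infty = (size n)%:Z - (size m)%:Z.
    by apply: ordr_frac_infty => //; rewrite E invf_div.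
  by rewrite /=; move: (size n) (size m) => a b; lia.
have sn : size n = d.+1.
  move: hd; rewrite /degr size_n size_m; lia.
split=> //; first lia.
- have E0 : ramification_index f (affine 0) = ordr f (Some 0).
    by rewrite /ramification_index v0 {1}/affine polyC0 tofrac0 subr0.
  move: r0; rewrite E0 (ordr_frac_affine _ n0 m0 E) => hm.
  rewrite -['X]subr0 -[0 : {poly K}]polyC0 -mup_geq //.
  by move: (mup 0 n) (mup 0 m) hm => a b; lia.
(* As f(1) is finite, m has no root at 1, and the whole order of f - 1 there comes from n - m. *)
- have m1 : m.[1] != 0.
    apply: contra_eq_neq v1 => m1.
    by rewrite /= Em hornerZ m1 mulr0 eqxx.
  have E1 : ramification_index f (affine 1) = ordr (f - 1) (Some 1).
    by rewrite /ramification_index v1 {1}/affine polyC1 tofrac1.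
  have E2 : f - 1 = (n - m)%:F / m%:F.
    by rewrite E rmorphB /= mulrBl divff // tofrac_eq0.
  have [->|nm0] := eqVneq (n - m) 0; first by rewrite dvdp0.
  move: r1; rewrite E1 (ordr_frac_affine _ nm0 m0 E2) (mupNroot m1) subr0 => -[hm].
  by rewrite -polyC1 -mup_geq // hm.
Qed.
End LowestTerms.

(** * Reduction modulo p *)

(** Frobenius gives X^(m p^l) - 1 = (X^m - 1)^(p^l), and X - 1 divides X^m - 1. *)
Lemma pchar_poly_subX1_dvd (F : fieldType) (p l d e : nat) :
  p \in [pchar F] -> (p ^ l %| d)%N -> (e <= p ^ l)%N ->
  ('X - 1) ^+ e %| ('X^d - 1 : {poly F}).
Proof.
move=> pF /dvdnP[m ->] le_e.
have p_pr := pcharf_prime pF.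
have pX : [pchar {poly F}].-nat (p ^ l)%N.
  by rewrite pnatX (pnatE _ p_pr) (rmorph_pchar (@polyC F) pF).
have -> : 'X^(m * p ^ l) - 1 = ('X^m - 1) ^+ (p ^ l) :> {poly F}.
  by rewrite exprDn_pchar // exprNn_pchar // expr1n exprM.
apply: dvdp_trans (dvdp_exp2l _ le_e) _.
by apply: dvdp_exp2r; rewrite subrX1 dvdp_mulr.
Qed.

Lemma reduction_monomial (F : fieldType) (p l d e1 e2 e3 : nat)
    (n m : {poly F}) :
  p \in [pchar F] -> (p ^ l %| d)%N -> (e2 <= p ^ l)%N ->
  (e1 + e2 + e3 = 2 * d + 1)%N -> (e1 <= d)%N -> (0 < e3 <= d)%N ->
  (size n <= d.+1)%N -> (size m + e3 <= d.+1)%N ->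
  'X^e1 %| n -> ('X - 1) ^+ e2 %| n - m -> (n != 0) || (m != 0) ->
  exists2 b, b != 0 & n = b *: 'X^d /\ m = b%:P.
Proof.
move=> pF pld le_e2 hs le_e1 he3 sn sm dvd0 dvd1 nm.
have E : n = 'X^d * m.
  have co : coprimep ('X^e1) (('X - 1) ^+ e2 : {poly F}).
    apply: coprimep_expl; apply: coprimep_expr.
    by rewrite -polyC1 coprimep_XsubC /root hornerX oner_eq0.
  have : 'X^e1 * ('X - 1) ^+ e2 %| n - 'X^d * m.
    rewrite Gauss_dvdp //; apply/andP; split.
      by rewrite dvdp_sub // dvdp_mulr // dvdp_exp2l.
    have -> : n - 'X^d * m = (n - m) - ('X^d - 1) * m by ring.
    by rewrite dvdp_sub // dvdp_mulr // (pchar_poly_subX1_dvd pF pld le_e2).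
  move/dvdp_leq => h; apply/eqP; rewrite -subr_eq0; apply: contraT => /h.
  have -> : size ('X^e1 * ('X - 1) ^+ e2 : {poly F}) = (e1 + e2).+1.
    rewrite -polyC1 size_mul ?expf_neq0 ?polyX_eq0 ?polyXsubC_eq0 //.
    by rewrite size_polyXn size_exp_XsubC; lia.
  (* Degree count: ['X^d * m] has degree at most 2d - e3 = e1 + e2 - 1, and so has n because e3 <=
     d, while the divisor has degree e1 + e2. *)
  have := size_polyD n (- ('X^d * m)); rewrite size_polyN.
  have := size_polyMleq 'X^d m; rewrite size_polyXn.
  by move: (size (n - _)) (size ('X^d * m)) (size n) (size m) sn sm => a b c e; lia.
have m0 : m != 0.
  by apply: contraTneq nm => m0; rewrite E m0 mulr0 eqxx.
have sm1 : (size m <= 1)%N.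
  move: sn; rewrite E size_monicM ?monicXn // size_polyXn.
  by move: (size m) => a; lia.
have Em := size1_polyC sm1.
exists m`_0; first by rewrite -polyC_eq0 -Em.
by split=> //; rewrite E Em coefC eqxx mulrC mul_polyC.
Qed.

(** * Integral models of a pair of rational polynomials *)

Lemma joint_primitive (n m : {poly rat}) : (n != 0) || (m != 0) ->
  exists (a : rat) (n0 m0 : {poly int}),
    [/\ a != 0, n = a *: map_poly intr n0, m = a *: map_poly intr m0 &
      forall p : nat, prime p -> (map_poly intr n0 != 0 :> {poly 'F_p})
                              || (map_poly intr m0 != 0 :> {poly 'F_p})].
Proof.
(* Packing n and m into one polynomial lets [zprimitive] clear their common content. *)
move=> nm; set k := size n; pose q := n + m * 'X^k.
have En : take_poly k q = n.
  apply/polyP => i; rewrite !coefE; case: ltnP => // hi; first by rewrite addr0.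
  by rewrite nth_default.
have Em : drop_poly k q = m.
  apply/polyP => i; rewrite !coefE ltnNge leq_addl /= addnK.
  by rewrite nth_default ?add0r // leq_addl.
have q0 : q != 0.
  apply: contraTneq nm => q0; rewrite -En -Em q0 negb_or !negbK.
  by apply/andP; split; apply/eqP/polyP => i; rewrite !coefE ?if_same.
have [z [c c0 Eq]] := rat_poly_scale q.
have z0 : z != 0 by apply: contraNneq q0 => z0; rewrite Eq z0 rmorph0 scaler0.
set w := zprimitive z.
have Eqw : q = ((zcontents z)%:~R / c%:~R) *: map_poly intr w.
  rewrite Eq [z in LHS]zpolyEprim -/w.
  by rewrite map_polyZ scalerA mulrC.
exists ((zcontents z)%:~R / c%:~R), (take_poly k w), (drop_poly k w); split.
- by rewrite mulf_neq0 ?invr_neq0 ?intr_eq0 ?zcontents_eq0.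
- rewrite -[LHS]En Eqw;
  apply/polyP => i; rewrite !(coef_take_poly, coef_drop_poly, coefZ, coef_map) /=.
  by case: ifP; rewrite ?mulr0.
- by rewrite -[LHS]Em Eqw;
  apply/polyP => i; rewrite !(coef_take_poly, coef_drop_poly, coefZ, coef_map) /=.
move=> p p_pr; rewrite -negb_and; apply/negP => /andP[/eqP n0 /eqP m0].
(* If both halves vanished mod p, then p would divide every coefficient of [w], hence its content,
   which is 1. *)
have dvd_p : w \is a polyOver (dvdz p).
  apply/polyOverP => i; rewrite (dvdz_pcharf (pchar_Fp p_pr)).
  have [hi|hi] := ltnP i k.
    by move/polyP/(_ i): n0; rewrite !(coef_map, coef_take_poly, coef0) /= hi => ->.
  by move/polyP/(_ (i - k)%N): m0; rewrite !(coef_map, coef_drop_poly, coef0) /= subnK // => ->.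
move: dvd_p; rewrite -dvdz_contents zcontents_primitive z0 dvdz1 /=.
by rewrite gtn_eqF ?prime_gt1.
Qed.

(** * Binary forms of degree d *)

Section Homogenization.
Variables (R : comPzRingType) (d : nat).
Implicit Types (n m : nat -> R) (u v s t : R).

Definition homog n u v := \sum_(i < d.+1) n i * (u ^+ i * v ^+ (d - i)).

Lemma homogD n m u v : homog (fun i => n i + m i) u v = homog n u v + homog m u v.
Proof. by rewrite -big_split; apply: eq_bigr => i _; rewrite mulrDl. Qed.

Lemma homogZ a n u v : homog (fun i => a * n i) u v = a * homog n u v.
Proof. by rewrite /homog mulr_sumr; apply: eq_bigr => i _; rewrite -mulrA. Qed.

Lemma homog_Xd u v : homog (fun i => (i == d)%:R) u v = u ^+ d.
Proof.
rewrite /homog big_ord_recr /= eqxx subnn mulr1 mul1r big1 ?add0r // => i _.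
by rewrite ltn_eqF // mul0r.
Qed.

Lemma homog_1 u v : homog (fun i => (i == 0%N)%:R) u v = v ^+ d.
Proof.
rewrite /homog big_ord_recl /= subn0 !mul1r big1 ?addr0 // => i _.
by rewrite mul0r.
Qed.

(** The determinant of the images of (u : v) and (s : t) under the pair of forms; u t - s v is the
    determinant of the points themselves. *)
Definition cross n m u v s t := homog n u v * homog m s t - homog n s t * homog m u v.

(** For i >= j, common powers of u s and v t factor out and leave (u t)^b - (s v)^b with b = i - j.
    Swapping i and j only changes the sign. *)
Lemma monomial_cross i j u v s t : (i <= d)%N -> (j <= d)%N ->
  exists c, u ^+ i * v ^+ (d - i) * (s ^+ j * t ^+ (d - j))
    - s ^+ i * t ^+ (d - i) * (u ^+ j * v ^+ (d - j)) = (u * t - s * v) * c.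
Proof.
suff main a b : (a + b <= d)%N ->
    exists c, u ^+ (a + b) * v ^+ (d - (a + b)) * (s ^+ a * t ^+ (d - a))
    - s ^+ (a + b) * t ^+ (d - (a + b)) * (u ^+ a * v ^+ (d - a))
    = (u * t - s * v) * c.
  move=> le_i le_j; case: (leqP j i) => [le_ji|/ltnW le_ij].
    by have := main j (i - j)%N; rewrite subnKC //; apply.
  have := main i (j - i)%N; rewrite subnKC // => /(_ le_j)[c E].
  by exists (- c); rewrite mulrN -E; ring.
move=> le_ab.
exists (u ^+ a * s ^+ a * v ^+ (d - (a + b)) * t ^+ (d - (a + b))
        * \sum_(i < b) (u * t) ^+ (b.-1 - i) * (s * v) ^+ i).
rewrite [RHS]mulrCA -subrXX !exprMn.
have -> : (d - a = b + (d - (a + b)))%N by lia.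
by rewrite !exprD; ring.
Qed.

(** Bilinear expansion reduces this to monomials. It follows that any pair of forms preserves
    congruences between points. *)
Lemma cross_dvd n m u v s t : exists c, cross n m u v s t = (u * t - s * v) * c.
Proof.
pose M (i j : 'I_d.+1) := u ^+ i * v ^+ (d - i) * (s ^+ j * t ^+ (d - j))
    - s ^+ i * t ^+ (d - i) * (u ^+ j * v ^+ (d - j)).
have -> : cross n m u v s t = \sum_(i < d.+1) \sum_(j < d.+1) n i * m j * M i j.
  rewrite /cross /homog !mulr_suml -sumrB; apply: eq_bigr => i _.
  by rewrite !mulr_sumr -sumrB; apply: eq_bigr => j _; rewrite /M; ring.
apply: (big_ind (fun x => exists c, x = (u * t - s * v) * c)).
- by exists 0; rewrite mulr0.
- by move=> _ _ [a ->] [b ->]; exists (a + b); rewrite mulrDr.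
move=> i _; apply: (big_ind (fun x => exists c, x = (u * t - s * v) * c)).
- by exists 0; rewrite mulr0.
- by move=> _ _ [a ->] [b ->]; exists (a + b); rewrite mulrDr.
move=> j _; have [||c E] := @monomial_cross i j u v s t; rewrite -1?ltnS //.
by exists (n i * m j * c); rewrite /M E; ring.
Qed.

End Homogenization.

Lemma homog_horner (K : fieldType) d (q : {poly K}) u v :
  (size q <= d.+1)%N -> v != 0 -> homog d (fun i => q`_i) u v = q.[u / v] * v ^+ d.
Proof.
move=> sq v0; rewrite (horner_coef_wide _ sq) mulr_suml; apply: eq_bigr => i _.
rewrite -mulrA; congr (_ * _); rewrite expr_div_n.
have -> : v ^+ d = v ^+ i * v ^+ (d - i) by rewrite -exprD subnKC // -ltnS.
by rewrite mulrA divfK // expf_neq0.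
Qed.

Lemma rmorph_homog (R S : comPzRingType) (g : {rmorphism R -> S}) d n u v :
  g (homog d n u v) = homog d (fun i => g (n i)) (g u) (g v).
Proof. by rewrite rmorph_sum; apply: eq_bigr => i _; rewrite !rmorphM !rmorphXn. Qed.

(** The cofactor of x - y in x^d - y^d is d x^(d-1) mod p, since k > 0 gives x = y mod p; it
    vanishes because p divides d. *)
Lemma dvdz_subXX (p d k : nat) (x y : int) : prime p -> (p %| d)%N -> (0 < k)%N ->
  ((p ^ k)%N%:Z %| x - y)%Z -> ((p ^ k.+1)%N%:Z %| x ^+ d - y ^+ d)%Z.
Proof.
move=> p_pr pd k0 h.
have pF := pchar_Fp p_pr.
rewrite subrXX expnSr PoszM dvdz_mul // (dvdz_pcharf pF).
have exy : x%:~R = y%:~R :> 'F_p.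
  apply/eqP; rewrite -subr_eq0 -rmorphB -(dvdz_pcharf pF) /=.
  by apply: dvdz_trans h; rewrite dvdzE /= dvdn_exp.
rewrite rmorph_sum /= (eq_bigr (fun=> x%:~R ^+ d.-1)).
  rewrite sumr_const card_ord -mulr_natr.
  have -> : d%:R = 0 :> 'F_p by apply/eqP; rewrite -(dvdn_pcharf pF).
  by rewrite mulr0.
move=> i _; rewrite rmorphM !rmorphXn /= -exy -exprD; congr (_ ^+ _).
by have := ltn_ord i; lia.
Qed.

(** * Integer coordinates and p-adic closeness on the rational projective line *)

Section Coordinates.
Variable p : nat.
Implicit Types (P Q : P1 rat) (u v s t : int).

(* The coordinates need not be coprime, only not both divisible by p. *)
Definition coords P u v : Prop :=
  ~~ ((p %| u)%Z && (p %| v)%Z) /\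
  P = if v == 0 then infty else affine (u%:~R / v%:~R).

Lemma coords_neq0 P u v : coords P u v -> (u != 0) || (v != 0).
Proof.
case=> h _; apply: contraR h; rewrite negb_or !negbK => /andP[/eqP-> /eqP->].
by rewrite dvdz0.
Qed.

Lemma coords_exist P : prime p -> exists u v, coords P u v.
Proof.
move=> p_pr; case: P => [x|]; last first.
  exists 1, 0; split=> //; rewrite negb_and dvdz1 /=.
  by rewrite gtn_eqF ?prime_gt1.
exists (numq x), (denq x); split; last by rewrite denq_eq0 /= divq_num_den.
apply/negP => /andP[hn hd].
have : (p %| gcdn `|numq x| `|denq x|)%N by rewrite dvdn_gcd; apply/andP.
by rewrite (eqP (coprime_num_den x)) dvdn1 gtn_eqF ?prime_gt1.
Qed.

Lemma coords_prop P u v s t : coords P u v -> coords P s t -> u * t = s * v.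
Proof.
move=> [_ ->] [_]; have [->|v0] := eqVneq v 0; have [->|t0] := eqVneq t 0 => //.
  by rewrite !mulr0.
case=> /eqP; rewrite eqr_div ?intr_eq0 // -!intrM eqr_int => /eqP E.
by rewrite E mulrC.
Qed.

Lemma eq_coords P Q u v s t : coords P u v -> coords Q s t ->
  u * t = s * v -> P = Q.
Proof.
move=> hP hQ; have := coords_neq0 hP; have := coords_neq0 hQ.
case: hP => _ ->; case: hQ => _ ->.
have [->|v0] := eqVneq v 0; have [->|t0] := eqVneq t 0 => //=.
- by rewrite mulr0 orbF => _ u0 /eqP; rewrite mulf_eq0 (negPf u0) (negPf t0).
- rewrite orbF mulr0 => s0 _ /esym/eqP.
  by rewrite mulf_eq0 (negPf s0) (negPf v0).
- move=> _ _ E; congr affine; apply/eqP.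
  by rewrite eqr_div ?intr_eq0 // -!intrM eqr_int E.
Qed.

(** Agreement modulo p^k, stated for all coordinates so that none has to be preferred; by [closeI]
    one choice suffices. *)
Definition close k P Q : Prop := forall u v s t, coords P u v -> coords Q s t ->
  ((p ^ k)%N %| u * t - s * v)%Z.

(** The two coordinate vectors of P are proportional and one of u, v is prime to p, so multiplying
    by that one loses no divisibility by p^k. *)
Lemma coords_dvdz k P u v u' v' s t : prime p ->
  coords P u v -> coords P u' v' ->
  ((p ^ k)%N %| u * s - t * v)%Z -> ((p ^ k)%N %| u' * s - t * v')%Z.
Proof.
move=> p_pr hP hP' h; have E := coords_prop hP hP'.
have cop (w : int) : ~~ (p %| w)%Z -> coprimez (p ^ k)%N w.
  by move=> hw; rewrite /coprimez -[_ == _]/(coprime _ _) coprimeXl // prime_coprime.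
case: hP => + _; rewrite negb_and => /orP[] /cop cw.
  rewrite -(Gauss_dvdzl _ cw).
  have -> : (u' * s - t * v') * u = u' * (u * s - t * v) + t * (u' * v - u * v').
    by ring.
  by rewrite E subrr mulr0 addr0 dvdz_mull.
rewrite -(Gauss_dvdzl _ cw).
have -> : (u' * s - t * v') * v = v' * (u * s - t * v) + s * (u' * v - u * v').
  by ring.
by rewrite E subrr mulr0 addr0 dvdz_mull.
Qed.

Lemma closeI k P Q u v s t : prime p -> coords P u v -> coords Q s t ->
  ((p ^ k)%N %| u * t - s * v)%Z -> close k P Q.
Proof.
move=> p_pr hP hQ h u' v' s' t' hP' hQ'.
have h1 := coords_dvdz p_pr hP hP' h.
have -> : u' * t' - s' * v' = - (s' * v' - u' * t') by ring.
rewrite rpredN; apply: (coords_dvdz p_pr hQ hQ').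
by rewrite -rpredN opprB.
Qed.

Lemma close_eq P Q : prime p -> (forall k, close k P Q) -> P = Q.
Proof.
move=> p_pr h.
have [u [v hP]] := coords_exist P p_pr.
have [s [t hQ]] := coords_exist Q p_pr.
apply: (eq_coords hP hQ); apply/eqP; rewrite -subr_eq0 -absz_eq0.
set w := (_ - _); apply: contraT; rewrite -lt0n => w0.
(* The exponent k = |w| suffices, as p^|w| > |w|. *)
have := h `|w|%N _ _ _ _ hP hQ; rewrite dvdzE /= => /(dvdn_leq w0).
by rewrite leqNgt ltn_expl // prime_gt1.
Qed.
End Coordinates.

(** * Contraction on residue discs *)

(* [f] acts on coordinates by a pair of forms that is congruent to
   b (u^d, v^d) mod p. *)
Section Dynamics.
Variables (p d : nat) (b : int) (n n1 m m1 : nat -> int).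
Hypothesis p_pr : prime p.
Hypothesis pb : ~~ (p %| b)%Z.
Hypothesis d_gt0 : (0 < d)%N.
Hypothesis nE : forall i, n i = b * (i == d)%:R + p%:Z * n1 i.
Hypothesis mE : forall i, m i = b * (i == 0%N)%:R + p%:Z * m1 i.

Lemma homog_numr u v : homog d n u v = b * u ^+ d + p%:Z * homog d n1 u v.
Proof. by rewrite -(homog_Xd d u v) -!homogZ -homogD; apply: eq_bigr => i _; rewrite nE. Qed.

Lemma homog_denr u v : homog d m u v = b * v ^+ d + p%:Z * homog d m1 u v.
Proof. by rewrite -(homog_1 d u v) -!homogZ -homogD; apply: eq_bigr => i _; rewrite mE. Qed.

Let pF := pchar_Fp p_pr.

Lemma homog_numr_mod u v : (homog d n u v)%:~R = b%:~R * u%:~R ^+ d :> 'F_p.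
Proof.
rewrite homog_numr rmorphD !rmorphM rmorphXn /=.
by rewrite [X in _ + X * _](pcharf0 pF) mul0r addr0.
Qed.

Lemma homog_denr_mod u v : (homog d m u v)%:~R = b%:~R * v%:~R ^+ d :> 'F_p.
Proof.
rewrite homog_denr rmorphD !rmorphM rmorphXn /=.
by rewrite [X in _ + X * _](pcharf0 pF) mul0r addr0.
Qed.

(** Good reduction: b is a unit mod p, so the forms have no common zero mod p and admissible
    coordinates go to admissible ones. *)
Lemma homog_dvdz u v : (p %| homog d n u v)%Z && (p %| homog d m u v)%Z =
  (p %| u)%Z && (p %| v)%Z.
Proof.
rewrite !(dvdz_pcharf pF) homog_numr_mod homog_denr_mod !mulf_eq0.
by rewrite -(dvdz_pcharf pF b) (negPf pb) /= !expf_eq0 d_gt0.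
Qed.

Lemma cross_lift k u v s t : (p %| d)%N -> (0 < k)%N ->
  ((p ^ k)%N %| u * t - s * v)%Z ->
  ((p ^ k.+1)%N %|
    homog d n u v * homog d m s t - homog d n s t * homog d m u v)%Z.
Proof.
move=> pd k0 h.
have hd (x y : nat -> int) : ((p ^ k)%N %| cross d x y u v s t)%Z.
  by have [c ->] := cross_dvd d x y u v s t; rewrite dvdz_mulr.
pose X (i : nat) : int := (i == d)%:R; pose I (i : nat) : int := (i == 0%N)%:R.
(* The leading term gains a factor p from p | d. Every other term shows a factor p, and its
   determinant is divisible by p^k. *)
have -> : homog d n u v * homog d m s t - homog d n s t * homog d m u v =
   b ^+ 2 * ((u * t) ^+ d - (s * v) ^+ d)
   + p%:Z * (b * cross d X m1 u v s t + b * cross d n1 I u v s t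
             + p%:Z * cross d n1 m1 u v s t).
  by rewrite !homog_numr !homog_denr /cross !homog_Xd !homog_1 !exprMn; ring.
rewrite rpredD //.
  by rewrite dvdz_mull // dvdz_subXX.
by rewrite expnS PoszM dvdz_mul // !rpredD // dvdz_mull.
Qed.

Variable f : P1 rat -> P1 rat.
Hypothesis fE : forall P u v, coords p P u v ->
  coords p (f P) (homog d n u v) (homog d m u v).
Hypothesis pd : (p %| d)%N.
Hypothesis frob : forall z : 'F_p, (z ^+ d) ^+ d = z ^+ d.

Lemma close_map k P Q : (0 < k)%N -> close p k P Q -> close p k.+1 (f P) (f Q).
Proof.
move=> k0 h.
have [u [v hP]] := coords_exist P p_pr.
have [s [t hQ]] := coords_exist Q p_pr.
apply: (closeI p_pr (fE hP) (fE hQ)).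
by apply: cross_lift => //; apply: h.
Qed.

Lemma close_image P : close p 1 (f P) (f (f P)).
Proof.
have [u [v hP]] := coords_exist P p_pr.
apply: (closeI p_pr (fE hP) (fE (fE hP))).
rewrite expn1 (dvdz_pcharf pF) rmorphB !rmorphM /=.
rewrite !(homog_numr_mod, homog_denr_mod) !exprMn !frob.
by apply/eqP; ring.
Qed.

Lemma close_iter k P : close p k.+1 (iter k.+1 f P) (iter k.+2 f P).
Proof.
by elim: k => [|k IH]; [exact: close_image | exact: close_map].
Qed.

Lemma periodic_fixed P : periodic f P -> f P = P.
Proof.
move=> [r r0 hr].
have iterP k : iter (k * r) f P = P by elim: k => // k; rewrite mulSn addnC iterD hr.
apply/esym/(close_eq p_pr) => k u v s t hP hfP.
(* The iterate (k + 1) r is a multiple of the period, is positive, and is at least k. *)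
have := @close_iter (k.+1 * r).-1 P.
rewrite prednK ?muln_gt0 // !iterS iterP => /(_ _ _ _ _ hP hfP).
apply: dvdz_trans; rewrite dvdzE /= dvdn_exp2l //.
by apply: leq_trans (leq_pmulr _ r0).
Qed.
End Dynamics.

(** * Application to Belyi maps *)

Lemma preperiodic_fixed (T : Type) (f : T -> T) :
  (forall P, periodic f P -> f P = P) ->
  forall P, preperiodic f P -> exists m : nat, iter m f P = iter m.+1 f P.
Proof.
move=> h P [n [m [nm E]]].
wlog lt_nm : n m nm E / (n < m)%N.
  move=> main; case: (ltngtP n m) => [lt|lt|//]; first exact: (main n m).
  exact: (main m n (nesym nm) (esym E)).
(* The point f^n(P) has period m - n, hence is fixed. *)
exists n; rewrite iterS h //; exists (m - n)%N; first by rewrite subn_gt0.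
by rewrite -iterD subnK ?E // ltnW.
Qed.

(** Links [evalr] to the forms. At infinity the denominator form vanishes, its coefficient of index
    d being 0; elsewhere the common factor v^d / a cancels. *)
Lemma coords_evalr (f : {fraction {poly rat}}) (p d : nat) (a : rat)
    (n0 m0 : {poly int}) P u v :
  a != 0 -> numr f = a *: map_poly intr n0 -> denr f = a *: map_poly intr m0 ->
  size (numr f) = d.+1 -> (size (denr f) <= d)%N ->
  (p %| homog d (fun i => n0`_i) u v)%Z && (p %| homog d (fun i => m0`_i) u v)%Z
    = (p %| u)%Z && (p %| v)%Z ->
  coords p P u v ->
  coords p (evalr f P) (homog d (fun i => n0`_i) u v) (homog d (fun i => m0`_i) u v).
Proof.
move=> a0 En Em sn sm hp [puv ->]; split; first by rewrite hp.
have hd : degr f = d.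
  by rewrite /degr sn; apply/maxn_idPl; apply: leq_trans sm; rewrite leq_pred.
have rat_homog (q : {poly int}) :
    (homog d (fun i => q`_i) u v)%:~R
    = homog d (fun i => (map_poly intr q : {poly rat})`_i) u%:~R v%:~R.
  by rewrite rmorph_homog; apply: eq_bigr => i _; rewrite coef_map.
have md : m0`_d = 0.
  apply/eqP; rewrite -(intr_eq0 rat) -(coef_map (intr : int -> rat)).
  by rewrite nth_default // (leq_trans _ sm) // Em size_scale.
have [v0|v0] := eqVneq v 0.
  rewrite /= hd Em coefZ coef_map md mulr0 eqxx v0.
  rewrite [homog _ (fun i => m0`_i) _ _]big_ord_recr /= md mul0r addr0 big1 ?eqxx //.
  by move=> i _; rewrite expr0n subn_eq0 leqNgt ltn_ord !mulr0.
have v0' : v%:~R != 0 :> rat by rewrite intr_eq0.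
have hN : (homog d (fun i => n0`_i) u v)%:~R = (numr f).[u%:~R / v%:~R] / a * v%:~R ^+ d.
  rewrite rat_homog homog_horner //; last by rewrite -sn En size_scale.
  by rewrite En hornerZ [a * _]mulrC mulfK.
have hD : (homog d (fun i => m0`_i) u v)%:~R = (denr f).[u%:~R / v%:~R] / a * v%:~R ^+ d.
  rewrite rat_homog homog_horner //; last by rewrite -(size_scale _ a0) -Em leqW.
  by rewrite Em hornerZ [a * _]mulrC mulfK.
rewrite /= -(intr_eq0 rat) hN hD !mulf_eq0 invr_eq0 (negPf a0) expf_eq0 (negPf v0').
rewrite andbF !orbF; case: eqP => // _; congr affine.
by rewrite -!mulf_div !divff ?mulr1 ?invr_neq0 // expf_neq0.
Qed.

(** If d is a power of p, then z^d = z by Fermat. A nonzero z is 1 for p = 2, and for p = 3 it has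
    square 1, so only the parity of d matters. *)
Lemma Fp_expn_idem (p l d : nat) (z : 'F_p) : prime p ->
  [\/ p = 2, p = 3 | d = (p ^ l)%N] -> (0 < d)%N -> (z ^+ d) ^+ d = z ^+ d.
Proof.
move=> p_pr h d0.
have zp (x : 'F_p) : x ^+ p = x by have := expf_card x; rewrite card_Fp.
have [p2|p3|->] := h; last first.
- by elim: l {h} => [|k IH]; rewrite ?expr1 // expnS !exprM !zp.
- subst p; have [-> | z0] := eqVneq z 0; first by rewrite !expr0n gtn_eqF ?expr0n ?gtn_eqF.
  have z2 : z ^+ 2 = 1 by apply: (mulfI z0); rewrite mulr1 -exprS zp.
  have: z ^+ d = z ^+ odd d.
    by rewrite -{1}(odd_double_half d) -mul2n exprD exprM z2 expr1n mulr1.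
  by case: (odd d) => /= E; rewrite E ?expr1n // expr1 E.
subst p; have [-> | z0] := eqVneq z 0; first by rewrite !expr0n gtn_eqF ?expr0n ?gtn_eqF.
have -> : z = 1 by apply: (mulfI z0); rewrite mulr1 -expr2 zp.
by rewrite !expr1n.
Qed.

(** Division by a monic polynomial stays in Z[X], so the quotient is integral and can be mapped to
    any field. *)
Lemma monic_dvdp_int (q n0 : {poly int}) (a : rat) : q \is monic -> a != 0 ->
  map_poly intr q %| a *: map_poly intr n0 ->
  forall F : fieldType, (map_poly intr q : {poly F}) %| map_poly intr n0.
Proof.
move=> q_mon a0; rewrite dvdpZr // dvdp_rat_int => /(Pdiv.IdomainMonic.dvdpP q_mon).
by move=> [r ->] F; rewrite rmorphM dvdp_mull.
Qed.

Lemma belyi_periodic_fixed (R : realType) (f : {fraction {poly rat}})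
    (d e1 e2 e3 p l : nat) :
  normalized_belyi (complexify R f) d e1 e2 e3 -> prime p ->
  [\/ [/\ p = 2, (2 %| d)%N & l = logn 2 d],
      [/\ p = 3, (3 %| d)%N & l = logn 3 d] | d = (p ^ l)%N] ->
  (e2 <= p ^ l)%N ->
  forall P, periodic (evalr f) P -> evalr f P = P.
Proof.
move=> hf hp hl he2 P.
have := normalized_belyi_lowest_terms _ _ erefl hf.
rewrite map_poly_eq0 coprimep_map coprimep_numr_denr denr_neq0.
case=> // -[hs h1 h2 h3]; rewrite !size_map_poly => -[sn sm].
pose toC : {poly rat} -> {poly complex R} := map_poly ratr.
have -> : 'X^e1 = toC 'X^e1 by rewrite /toC map_polyXn.
have -> : ('X - 1) ^+ e2 = toC (('X - 1) ^+ e2).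
  by rewrite /toC rmorphXn rmorphB rmorph1 /= map_polyX.
(* All polynomials involved are rational, so the divisibilities descend from the complex numbers to
   Q. *)
rewrite -rmorphB /toC !dvdp_map => dvd0 dvd1.
have d0 : (0 < d)%N by lia.
have pld : (p ^ l %| d)%N.
  by case: hl => [[-> _ ->]|[-> _ ->]|->]; rewrite ?pfactor_dvdnn.
have pd : (p %| d)%N.
  case: (hl) => [[-> //]|[-> //]|dl]; rewrite dl dvdn_exp //.
  (* The exponent l = 0 would give d = 1, excluded by 2 <= e1 <= d. *)
  by case: l dl {hl he2 pld} => // d1; move: h1; rewrite d1; lia.
have [|a [n0 [m0 [a0 En Em hprim]]]] := @joint_primitive (numr f) (denr f).
  by rewrite denr_neq0 orbT.
pose red : {poly int} -> {poly 'F_p} := map_poly intr.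
have size_n0 : size n0 = d.+1.
  by rewrite -sn En size_scale // size_map_inj_poly ?rmorph0 //; apply: intr_inj.
have size_m0 : size m0 = size (denr f).
  by rewrite Em size_scale // size_map_inj_poly ?rmorph0 //; apply: intr_inj.
have red_size (q : {poly int}) : (size (red q) <= size q)%N by exact: size_poly.
have redX : red 'X^e1 = 'X^e1 by rewrite /red map_polyXn.
have redX1 : red (('X - 1) ^+ e2) = ('X - 1) ^+ e2.
  by rewrite /red rmorphXn rmorphB rmorph1 /= map_polyX.
have [|||||||b b0 [Ebn Ebm]] := @reduction_monomial 'F_p p l d e1 e2 e3
  (red n0) (red m0) (pchar_Fp hp) pld he2 hs.
- lia.
- lia.
- by rewrite (leq_trans (red_size n0)) // size_n0.
- by apply: leq_trans (eq_leq sm); rewrite leq_add2r -size_m0.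
- rewrite -redX; apply: (monic_dvdp_int (monicXn _ _) a0).
  by rewrite -En map_polyXn.
- rewrite -redX1 -rmorphB /red.
  apply: (@monic_dvdp_int _ _ a) => //.
    by rewrite monic_exp // -polyC1 monicXsubC.
  by rewrite rmorphXn !rmorphB rmorph1 /= map_polyX scalerBr -En -Em.
- exact: hprim.
(* An integer lift of b; [n1] and [m1] are the exact quotients by p of the differences from the
   lifted monomials. *)
pose B : int := Posz b.
have EB : B%:~R = b by rewrite -[LHS]/(b%:R) natr_Zp.
pose n1 i := ((n0`_i - B * (i == d)%:R) %/ p)%Z.
pose m1 i := ((m0`_i - B * (i == 0%N)%:R) %/ p)%Z.
have lift (x y : int) : x%:~R = y%:~R :> 'F_p -> x = y + p%:Z * ((x - y) %/ p)%Z.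
  move=> E; rewrite mulrC divzK ?subrKC // (dvdz_pcharf (pchar_Fp hp)).
  by rewrite rmorphB /= E subrr.
have nE i : n0`_i = B * (i == d)%:R + p%:Z * n1 i.
  apply: lift; move/polyP/(_ i): Ebn.
  by rewrite coef_map coefZ coefXn /= => ->; rewrite rmorphM rmorph_nat /= EB.
have mE i : m0`_i = B * (i == 0%N)%:R + p%:Z * m1 i.
  apply: lift; move/polyP/(_ i): Ebm.
  rewrite coef_map coefC /= => ->; rewrite rmorphM rmorph_nat /= EB.
  by case: eqP; rewrite ?mulr1 ?mulr0.
have pB : ~~ (p %| B)%Z by rewrite (dvdz_pcharf (pchar_Fp hp)) EB.
apply: (periodic_fixed hp nE mE _ pd) => [Q u v hQ|z].
  apply: (coords_evalr a0 En Em sn _ _ hQ); first by lia.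
  exact: (homog_dvdz hp pB d0 nE mE).
apply: (@Fp_expn_idem p l d z hp _ d0).
by case: hl => [[? _ _]|[? _ _]|?]; [apply: Or31 | apply: Or32 | apply: Or33].
Qed.

Local Close Scope ring_scope.

Theorem theorem6p1 (R : realType) (f : {fraction {poly rat}})
    (d e1 e2 e3 : nat)
    (hf : normalized_belyi (complexify R f) d e1 e2 e3)
    (p l : nat) (hp : prime p)
    (hl : [\/ [/\ p = 2, 2 %| d & l = logn 2 d],
              [/\ p = 3, 3 %| d & l = logn 3 d]
            | d = p ^ l])
    (he2 : e2 <= p ^ l) :
  (forall P : P1 rat, periodic (evalr f) P -> evalr f P = P) /\
  (forall P : P1 rat, preperiodic (evalr f) P ->
     exists m : nat, iter m (evalr f) P = iter m.+1 (evalr f) P).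
Proof.
have fixed := belyi_periodic_fixed hf hp hl he2.
by split=> //; apply: preperiodic_fixed.
Qed.
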